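(* Let $n \ge 3$ be an integer, and let $F_{n,\ell}$ ($1\le\ell\le n$) and, for $n$ odd, $E_{n,n-4}$ be the vectors defined in the context. 1. If $n$ is even, then $\left\{F_{n,1},\ldots,F_{n,\frac{n-2}{2}}\right\}$ is a linearly independent set of $\frac{n-2}{2}$ eigenvectors of $\mathcal{Q}(n)$ associated with the eigenvalue $n-4$. 2. If $n$ is odd, then $\left\{E_{n,n-4}, F_{n,1},\ldots,F_{n,\frac{n-1}{2}}\right\}$ is a linearly independent set of $\frac{n+1}{2}$ eigenvectors of $\mathcal{Q}(n)$ associated with the eigenvalue $n-4$.
   Context: Write $[n] = \{1,\dots,n\}$. The $n$-Queens graph $\mathcal{Q}(n)$ is the simple graph whose vertices are the $n^2$ squares $(i,j) \in [n]^2$ of an $n\times n$ chessboard ($i$ is the row, $j$ is the column), two distinct vertices being adjacent if and only if they lie in the same row, the same column, or the same diagonal; that is, distinct $(i,j)$ and $(p,q)$ are adjacent iff $i=p$, or $j=q$, or $i+j=p+q$, or $i-j=p-q$. Eigenvalues and eigenvectors of $\mathcal{Q}(n)$ are those of its adjacency matrix, which acts on vectors $v = (v_{(i,j)})_{(i,j)\in[n]^2}$ with real coordinates indexed by the squares. For $n\ge 3$ and $1\le\ell\le n$, define vectors with coordinates indexed by $[n]^2$ by: $(C_{n,\ell})_{(i,j)} = 1$ if $j=\ell$ or $j=n+1-\ell$, and $0$ otherwise; $(R_{n,\ell})_{(i,j)} = -1$ if $i=\ell$ or $i=n+1-\ell$, and $0$ otherwise; and $F_{n,\ell} = C_{n,\ell}+R_{n,\ell}$.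 For $n\ge 3$ odd, $E_{n,n-4} = P+Q$, where $P_{(i,j)} = \frac{n+1}{2}$ if $i=j$ and $P_{(i,j)}=0$ otherwise, and $Q_{(i,j)} = -\frac{n+1}{2}$ if $i+j=n+1$ and $Q_{(i,j)}=0$ otherwise. *)

(* Defs.v *)
From HB Require Import structures.
From mathcomp Require Import all_boot all_order all_algebra.
From mathcomp Require Import reals.

Set Implicit Arguments.
Unset Strict Implicit.
Unset Printing Implicit Defensive.

Import Order.TTheory GRing.Theory Num.Theory.
Local Open Scope ring_scope.

(* A simple graph is a symmetric irreflexive relation on a finType T. Vectors
   with coordinates indexed by T are column vectors of height #|T|, the
   coordinate at x : T being the one of index enum_rank x. *)
Section SpectralGraph.
Variables (R : realType) (T : finType).

Definition vec_of (f : T -> R) : 'cV[R]_#|T| := \col_k f (enum_val k).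

Lemma vec_ofE (f : T -> R) (x : T) : vec_of f (enum_rank x) 0 = f x.
Proof. by rewrite mxE enum_rankK. Qed.

Definition adjacency_mx (e : rel T) : 'M[R]_#|T| :=
  \matrix_(k, m) (e (enum_val k) (enum_val m))%:R.

Definition graph_eigenvector (e : rel T) (a : R) (v : 'cV[R]_#|T|) : Prop :=
  v != 0 /\ adjacency_mx e *m v = a *: v.

End SpectralGraph.

Definition square (n : nat) : finType := ('I_n * 'I_n)%type.

(* Ordinals start at 0, whereas rows and columns are numbered 1, ..., n. *)
Definition sqrow n (s : square n) : nat := s.1.+1.
Definition sqcol n (s : square n) : nat := s.2.+1.

(* Differences are taken in int, since subtraction on nat truncates. *)
Definition queens (n : nat) : rel (square n) := fun s t =>
  (s != t) &&
  [|| sqrow s == sqrow t,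
      sqcol s == sqcol t,
      (sqrow s + sqcol s == sqrow t + sqcol t)%N
    | (sqrow s)%:Z - (sqcol s)%:Z == (sqrow t)%:Z - (sqcol t)%:Z].

Lemma queens_sym n : symmetric (@queens n).
Proof.
move=> s t; rewrite /queens eq_sym; congr (_ && [|| _, _, _ | _]);
  exact: eq_sym.
Qed.

Lemma queens_irr n : irreflexive (@queens n).
Proof. by move=> s; rewrite /queens eqxx. Qed.

Section Eigenvectors.
Variables (R : realType) (n : nat).

Definition Cvec (l : nat) : 'cV[R]_#|square n| :=
  vec_of (fun s : square n =>
    if (sqcol s == l) || (sqcol s == n + 1 - l)%N then 1 else 0).

Definition Rvec (l : nat) : 'cV[R]_#|square n| :=
  vec_of (fun s : square n =>
    if (sqrow s == l) || (sqrow s == n + 1 - l)%N then -1 else 0).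

Definition Fvec (l : nat) : 'cV[R]_#|square n| := Cvec l + Rvec l.

Definition Pvec : 'cV[R]_#|square n| :=
  vec_of (fun s : square n =>
    if sqrow s == sqcol s then (n%:R + 1) / 2 else 0).

Definition Qvec : 'cV[R]_#|square n| :=
  vec_of (fun s : square n =>
    if (sqrow s + sqcol s == n + 1)%N then - ((n%:R + 1) / 2) else 0).

Definition Evec : 'cV[R]_#|square n| := Pvec + Qvec.

End Eigenvectors.

(* Main.v *)
Require Import Defs.
From HB Require Import structures.
From mathcomp Require Import all_boot all_order all_algebra.
From mathcomp Require Import reals.
From mathcomp Require Import zify ring.

Set Implicit Arguments.
Unset Strict Implicit.
Unset Printing Implicit Defensive.

Import Order.TTheory GRing.Theory Num.Theory.
Local Open Scope ring_scope.

(** The row, the column, the diagonal and the antidiagonal of a square [s] meet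
    pairwise only in [s], so summing a function [f] over the neighbours of [s]
    amounts to adding its sums over these four lines and removing [4 * f s].
    Hence [f] is an eigenvector for [n - 4] as soon as it is nonzero and its
    four line sums through every [s] add up to [n * f s] ([queens_eigen]).

    The vector [F_l] is of the form [f (i, j) = g j - g i] with [g] invariant
    under the reversal of [1, ..., n].  Its row and column sums add up to
    [n * f s], the two occurrences of the sum of [g] cancelling.  Both diagonal
    sums vanish: transposition preserves every antidiagonal, transposition
    followed by a half-turn preserves every diagonal, and both negate [f].

    The vector [E] is a multiple of the indicator of the main diagonal minus
    that of the main antidiagonal, so its row and column sums vanish.  For odd
    [n], a diagonal meets the main antidiagonal in one square if [i - j] is even
    and in none otherwise; thus its sum is [n], if it is the main diagonal,
    minus this parity indicator ([diag_sum_cross]).  The mirror image of the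
    board exchanges the two kinds of diagonals and negates the vector, so that
    the parity indicators cancel in the total.

    Independence comes from coordinates that separate the vectors.  With [m] the
    number of vectors [F_l], the row [m + 1] is left untouched by all the
    [R_l], hence the coordinate at [(m + 1, l)] is nonzero on [F_l] alone among
    them; every [F_l] vanishes at the corner [(1, 1)], where [E] does not. *)

(** * Separating coordinates and linear independence *)

Section Separation.
Variables (K : fieldType) (p : nat).
Implicit Types (v : 'cV[K]_p) (X : seq 'cV[K]_p).

(** A coordinate is a linear form, so it vanishes on the span of [X]. *)
Lemma notin_span_coord (k : 'I_p) v X :
  v k 0 != 0 -> {in X, forall u : 'cV[K]_p, u k 0 = 0} -> v \notin <<X>>%VS.
Proof.
move=> vk0 Xk0; apply: contra vk0 => vX.
rewrite (coord_span (X := in_tuple X) vX) summxE big1 // => i _.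
by rewrite mxE Xk0 ?mulr0 // mem_nth.
Qed.

(** The coordinates [k] attached to the indices form, up to scaling, a system
    dual to the family [F]. *)
Lemma free_map_separated (I : eqType) (F : I -> 'cV[K]_p) (s : seq I) :
    uniq s ->
    {in s, forall l, exists k : 'I_p,
       F l k 0 != 0 /\ {in s, forall l', l' != l -> F l' k 0 = 0}} ->
  free [seq F l | l <- s].
Proof.
elim: s => [|l s IHs] /=; first by rewrite nil_free.
case/andP=> lNs us sep; rewrite free_cons; apply/andP; split.
  have [k [Flk F0]] := sep l (mem_head _ _).
  apply: (notin_span_coord Flk) => _ /mapP[l' l's ->].
  by apply: F0; [rewrite inE l's orbT | apply: contraNneq lNs => <-].
apply: IHs => // l' l's.
have [|k [Fl'k F0]] := sep l'; first by rewrite inE l's orbT.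
by exists k; split=> // l'' l''s; apply: F0; rewrite inE l''s orbT.
Qed.

End Separation.

(** * The adjacency operator of the queens graph *)

Lemma adjacency_vec_of (R : realType) (T : finType) (e : rel T) (f : T -> R) :
  adjacency_mx R e *m vec_of f = vec_of (fun s => \sum_t (e s t)%:R * f t).
Proof.
apply/matrixP => k j; rewrite !mxE (reindex (@enum_val T predT)) /=.
  by apply: eq_bigr => i _; rewrite !mxE.
exact/onW_bij/enum_val_bij.
Qed.

Section Queens.
Variables (R : realType) (n : nat).
Implicit Types (f : square n -> R) (s t : square n).

Definition diag_sum f s := \sum_(t : square n | (s.1 + t.2 == t.1 + s.2)%N) f t.
Definition anti_sum f s := \sum_(t : square n | (s.1 + s.2 == t.1 + t.2)%N) f t.

(** Two distinct squares share at most one line, whereas a square lies on all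
    four of its own: this accounts for the term [4 * (s == t)]. *)
Lemma queens_lines s t :
  (queens s t + 4 * (s == t) =
   (t.1 == s.1) + (t.2 == s.2) + (s.1 + t.2 == t.1 + s.2) +
   (s.1 + s.2 == t.1 + t.2))%N.
Proof.
case: s t => [i j] [a b]; rewrite /queens /sqrow /sqcol xpair_eqE /=.
rewrite -!val_eqE /=; move: (val i) (val j) (val a) (val b) => {}i {}j {}a {}b.
have -> : (i.+1%:Z - j.+1%:Z == a.+1%:Z - b.+1%:Z) = (i + b == a + j)%N by lia.
have -> : (i.+1 + j.+1 == a.+1 + b.+1)%N = (i + j == a + b)%N by lia.
rewrite !eqSS (eq_sym a) (eq_sym b).
case: (eqVneq i a); case: (eqVneq j b); case: (eqVneq (i + b)%N (a + j)%N);
  case: (eqVneq (i + j)%N (a + b)%N) => /=; lia.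
Qed.

Lemma sum_square f : \sum_t f t = \sum_i \sum_j f (i, j).
Proof. by rewrite pair_bigA; apply: eq_bigr => -[]. Qed.

Lemma queens_sum f s :
  \sum_t (queens s t)%:R * f t =
  \sum_j f (s.1, j) + \sum_i f (i, s.2) + diag_sum f s + anti_sum f s - 4 * f s.
Proof.
have -> : \sum_j f (s.1, j) = \sum_t (t.1 == s.1)%:R * f t.
  rewrite sum_square [RHS](bigD1 s.1) //= [X in _ + X]big1 => [|i i_s].
    by rewrite addr0; apply: eq_bigr => j _; rewrite eqxx mul1r.
  by rewrite big1 // => j _; rewrite (negPf i_s) mul0r.
have -> : \sum_i f (i, s.2) = \sum_t (t.2 == s.2)%:R * f t.
  rewrite sum_square; apply: eq_bigr => i _.
  rewrite [RHS](bigD1 s.2) //= eqxx mul1r.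
  by rewrite big1 ?addr0 // => j /negPf->; rewrite mul0r.
have -> : 4 * f s = \sum_t (4 * (s == t))%:R * f t.
  rewrite (bigD1 s) //= eqxx big1 ?addr0 // => t.
  by rewrite eq_sym => /negPf->; rewrite mul0r.
rewrite /diag_sum /anti_sum !(big_mkcond (fun t => _ == _)) /=.
apply/eqP; rewrite eq_sym subr_eq -!big_split /=; apply/eqP.
apply: eq_bigr => t _; rewrite -[RHS]mulrDl -natrD queens_lines !natrD !mulrDl.
by rewrite !mulr_natl !mulrb.
Qed.

Lemma queens_eigen f :
    (forall s, \sum_j f (s.1, j) + \sum_i f (i, s.2) + diag_sum f s
               + anti_sum f s = n%:R * f s) ->
  adjacency_mx R (@queens n) *m vec_of f = (n%:R - 4) *: vec_of f.
Proof.
move=> lines; rewrite adjacency_vec_of; apply/matrixP => k j.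
by rewrite !mxE queens_sum lines mulrBl.
Qed.

(** * The vectors with symmetric profile *)

(** The sum equals its own opposite, and [R] has characteristic zero. *)
Lemma sum_negated (P : pred (square n)) f (h : square n -> square n) :
    involutive h -> (forall t, P (h t) = P t) -> (forall t, f (h t) = - f t) ->
  \sum_(t | P t) f t = 0.
Proof.
move=> hK hP hf; set S := LHS.
have S_opp : S = - S.
  rewrite {1}/S (reindex_inj (inv_inj hK)) /= -sumrN.
  by apply: eq_big => t; [rewrite hP | rewrite hf].
by apply/eqP; rewrite -[_ == _](mulrn_eq0 S 2) mulr2n {2}S_opp subrr.
Qed.

(** The row and column sums give the whole right-hand side; reflecting the board
    across either main diagonal shows that the two diagonal sums vanish. *)
Lemma profile_lines (g : 'I_n -> R) s :
    (forall i, g (rev_ord i) = g i) ->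
  let f (t : square n) := g t.2 - g t.1 in
  \sum_j f (s.1, j) + \sum_i f (i, s.2) + diag_sum f s + anti_sum f s
  = n%:R * f s.
Proof.
move=> g_rev f; rewrite {3}/f /=.
have -> : diag_sum f s = 0.
  apply: (@sum_negated _ _ (fun t => (rev_ord t.2, rev_ord t.1))).
  - by case=> i j; rewrite /= !rev_ordK.
  - by case=> i j /=; have := ltn_ord i; have := ltn_ord j; lia.
  - by case=> i j; rewrite /f /= !g_rev opprB.
have -> : anti_sum f s = 0.
  apply: (@sum_negated _ _ (fun t => (t.2, t.1))).
  - by case.
  - by case=> i j /=; rewrite [X in _ == X]addnC.
  - by case=> i j; rewrite /f /= opprB.
rewrite /f /= 2!sumrB !big_const_ord !iter_addr_0; ring.
Qed.

(** * The cross of the two main diagonals *)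

Definition cross (t : square n) : R :=
  (t.1 == t.2)%:R - (t.1 == rev_ord t.2)%:R.

Lemma sum_cross_row i : \sum_j cross (i, j) = 0.
Proof.
rewrite sumrB (bigD1 i) //= eqxx big1 => [|j]; last first.
  by rewrite eq_sym => /negPf->.
rewrite (bigD1 (rev_ord i)) //= rev_ordK eqxx big1 ?subrr // => j.
by rewrite -(inj_eq rev_ord_inj) rev_ordK eq_sym => /negPf->.
Qed.

Lemma cross_rev t : cross (t.1, rev_ord t.2) = - cross t.
Proof. by rewrite /cross /= rev_ordK opprB. Qed.

Lemma cross_swap i j : cross (i, j) = cross (j, i).
Proof.
rewrite /cross /=; congr ((nat_of_bool _)%:R - (nat_of_bool _)%:R).
  exact: eq_sym.
by rewrite -(inj_eq rev_ord_inj) rev_ordK eq_sym.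
Qed.

Lemma sum_cross_col j : \sum_i cross (i, j) = 0.
Proof. by under eq_bigr do rewrite cross_swap; exact: sum_cross_row. Qed.

(** On the diagonal of [s], the difference [t.1 - t.2] is constant, so the
    diagonal meets the main antidiagonal, where the coordinates, counted
    from 0, add up to the even number [n - 1], only if this
    difference is even; it then does so in
    exactly one square of the board. *)
Lemma diag_sum_cross s : odd n ->
  diag_sum cross s = (s.1 == s.2)%:R * n%:R - (~~ odd (s.1 + s.2))%:R.
Proof.
case: s => a b /= n_odd; rewrite /diag_sum sumrB; congr (_ - _).
  rewrite big_mkcond sum_square /=.
  have -> : (a == b)%:R * n%:R = \sum_(i < n) (a == b)%:R :> R.
    by rewrite big_const_ord iter_addr_0 mulr_natr.
  apply: eq_bigr => i _.
  rewrite (bigD1 i) //= eqxx big1 => [|j]; last first.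
    by rewrite eq_sym => /negPf->; case: ifP.
  by rewrite addr0 (addnC a) eqn_add2l -val_eqE /=; case: (_ == _ :> nat).
rewrite big_mkcond sum_square exchange_big /=.
transitivity (\sum_(j < n) (a + j == rev_ord j + b)%N%:R : R).
  apply: eq_bigr => j _; rewrite [LHS](bigD1 (rev_ord j)) //= eqxx big1 => [|i].
    by rewrite addr0; case: eqP.
  by move/negPf->; case: ifP.
have := ltn_ord a; have := ltn_ord b => b_n a_n.
case: (boolP (odd _)) => /= ab_par.
  rewrite big1 // => j _; have jn := ltn_ord j.
  by have -> : (a + j == n - j.+1 + b)%N = false by lia.
(* The two equations [a + j = i + b] and [i + j = n - 1] give the column [j]. *)
have kn : ((n.-1 + b - a)./2 < n)%N by lia.
rewrite (bigD1 (Ordinal kn)) //= big1 => [|j jk].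
  have -> : (a + (n.-1 + b - a)./2 == n - (n.-1 + b - a)./2.+1 + b)%N by lia.
  by rewrite addr0.
have jn := ltn_ord j; move: jk; rewrite -val_eqE /= => jk.
by have -> : (a + j == n - j.+1 + b)%N = false by lia.
Qed.

(** Reversing the columns turns antidiagonals into diagonals and negates
    [cross]. *)
Lemma anti_sum_cross s : anti_sum cross s = - diag_sum cross (s.1, rev_ord s.2).
Proof.
pose h (t : square n) : square n := (t.1, rev_ord t.2).
have hK : involutive h by case=> i j; rewrite /h /= rev_ordK.
rewrite /anti_sum (reindex_inj (inv_inj hK)) -sumrN; apply: eq_big => t /=.
  case: s t => [a b] [i j] /=; have := ltn_ord j; have := ltn_ord b; lia.
by rewrite /h cross_rev.
Qed.

(** The two parity terms cancel because reversing the columns preserves the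
    parity of [s.1 + s.2] when [n] is odd. *)
Lemma cross_lines s : odd n ->
  \sum_j cross (s.1, j) + \sum_i cross (i, s.2) + diag_sum cross s
  + anti_sum cross s = n%:R * cross s.
Proof.
move=> n_odd; rewrite sum_cross_row sum_cross_col anti_sum_cross.
rewrite !diag_sum_cross //= /cross.
have -> : odd (s.1 + (n - s.2.+1)) = odd (s.1 + s.2).
  by case: s => i j /=; have := ltn_ord j; lia.
ring.
Qed.

End Queens.

(** * Coordinates and independence of the eigenvectors *)

Section Eigenvectors.
Variables (R : realType) (n : nat).

Definition col_profile l (i : 'I_n) : R :=
  ((i.+1 == l) || (i.+1 == n + 1 - l)%N)%:R.

Lemma FvecE l : Fvec R n l =
  vec_of (fun t : square n => col_profile l t.2 - col_profile l t.1).
Proof.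
apply/matrixP => k j; rewrite !mxE /sqrow /sqcol /col_profile.
by do 2!case: ifP => _; rewrite ?oppr0.
Qed.

Lemma Fvec_eigen l : (0 < l <= n)%N ->
  adjacency_mx R (@queens n) *m Fvec R n l = (n%:R - 4) *: Fvec R n l.
Proof.
move=> l_range; rewrite FvecE; apply: queens_eigen => s.
apply: (profile_lines (g := col_profile l)) => i.
congr (nat_of_bool _)%:R.
by rewrite /=; have := ltn_ord i; lia.
Qed.

Lemma EvecE : Evec R n = ((n%:R + 1) / 2) *: vec_of (@cross R n).
Proof.
apply/matrixP => k j; rewrite !mxE /cross /sqrow /sqcol eqSS -val_eqE /=.
set s := enum_val k; rewrite -val_eqE /=.
have -> : (s.1 == n - s.2.+1 :> nat)%N = (s.1.+1 + s.2.+1 == n + 1)%N.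
  by have := ltn_ord s.1; have := ltn_ord s.2; lia.
by do 2!case: eqP => _; rewrite /=; ring.
Qed.

Lemma Evec_eigen : odd n ->
  adjacency_mx R (@queens n) *m Evec R n = (n%:R - 4) *: Evec R n.
Proof.
move=> n_odd; rewrite EvecE -scalemxAr queens_eigen => [|s].
  by rewrite !scalerA mulrC.
exact: cross_lines.
Qed.

(** The coordinate at row [m + 1] and column [l], counted from 1, isolates
    [Fvec R n l]: for [l <= m < n / 2] this row is neither [l] nor its mirror
    image, and the columns [1, ..., m] do not contain each other's mirror
    images. *)
Lemma Fvec_free m : (m.*2 < n)%N -> free [seq Fvec R n l | l <- iota 1 m].
Proof.
move=> m_lt; apply: free_map_separated; first exact: iota_uniq.
move=> l; rewrite mem_iota => l_range.
have m_n : (m < n)%N by lia.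
have l_n : (l.-1 < n)%N by lia.
exists (enum_rank ((Ordinal m_n, Ordinal l_n) : square n)).
split=> [|l']; last rewrite mem_iota => l'_range l'_l.
all: rewrite FvecE vec_ofE /col_profile /=.
  have -> : (l.-1.+1 == l) || (l.-1.+1 == n + 1 - l)%N by lia.
  have -> : (m.+1 == l) || (m.+1 == n + 1 - l)%N = false by lia.
  by rewrite subr0 oner_eq0.
have -> : (l.-1.+1 == l') || (l.-1.+1 == n + 1 - l')%N = false by lia.
have -> : (m.+1 == l') || (m.+1 == n + 1 - l')%N = false by lia.
by rewrite subr0.
Qed.

(** The corner lies on the main diagonal and off the antidiagonal, so [Evec]
    does not vanish there, whereas each [Fvec] does, by antisymmetry. *)
Lemma Evec_Fvec_free m : (1 < n)%N -> (m.*2 < n)%N ->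
  free (Evec R n :: [seq Fvec R n l | l <- iota 1 m]).
Proof.
move=> n_gt1 m_lt; rewrite free_cons Fvec_free // andbT.
have n_gt0 : (0 < n)%N by lia.
pose corner : square n := (Ordinal n_gt0, Ordinal n_gt0).
apply: (@notin_span_coord _ _ (enum_rank corner)) => [|_ /mapP[l _ ->]].
  rewrite EvecE mxE vec_ofE /cross eqxx -val_eqE /=.
  have -> : (0 == n - 1)%N = false by lia.
  by rewrite subr0 mulr1 natr1 mulf_neq0 ?invr_eq0 ?pnatr_eq0.
by rewrite FvecE vec_ofE subrr.
Qed.

End Eigenvectors.

Theorem theorem4p1 (R : realType) (n : nat) (hn : (3 <= n)%N) :
  (~~ odd n ->
     let S := [seq Fvec R n l | l <- iota 1 ((n - 2) %/ 2)] in
     [/\ uniq S, size S = ((n - 2) %/ 2)%N, free S &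
         forall v, v \in S -> graph_eigenvector (@queens n) (n%:R - 4) v])
  /\
  (odd n ->
     let S := Evec R n :: [seq Fvec R n l | l <- iota 1 ((n - 1) %/ 2)] in
     [/\ uniq S, size S = ((n + 1) %/ 2)%N, free S &
         forall v, v \in S -> graph_eigenvector (@queens n) (n%:R - 4) v]).
Proof.
split=> n_par S.
  have S_free : free S by apply: Fvec_free; lia.
  split=> // [||v vS]; first exact: free_uniq.
    by rewrite size_map size_iota.
  split; first exact: free_not0 S_free vS.
  case/mapP: vS => l; rewrite mem_iota => l_range ->; apply: Fvec_eigen; lia.
have S_free : free S by apply: Evec_Fvec_free; lia.
split=> // [||v vS]; first exact: free_uniq.
  rewrite /= size_map size_iota; lia.
split; first exact: free_not0 S_free vS.
move: vS; rewrite inE => /predU1P[-> | /mapP[l]]; first exact: Evec_eigen.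
by rewrite mem_iota => l_range ->; apply: Fvec_eigen; lia.
Qed.
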